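(* For any integer $n\ge 2$ the polynomial $\tilde{p}_n(t)$ has only real zeros.
   Context: A prime parking function of length $n$ is a sequence $\mathbf{a}=(a_1,\ldots,a_n)$ of positive integers whose non-decreasing rearrangement $(b_1,\ldots,b_n)$ satisfies $b_1=1$ and $b_i<i$ for all $2\le i\le n$. Let $\mathcal{PPF}_n$ be the set of prime parking functions of length $n$, let $\mathrm{des}(\mathbf{a})$ be the number of indices $1\le i\le n-1$ with $a_i>a_{i+1}$, and let $\tilde{p}_n(t)=\sum_{\mathbf{a}\in\mathcal{PPF}_n}t^{\,n-1-\mathrm{des}(\mathbf{a})}$. *)

(* Defs.v *)
From mathcomp Require Import all_boot all_order all_algebra.

Set Implicit Arguments.
Unset Strict Implicit.
Unset Printing Implicit Defensive.

Import GRing.Theory.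

(* Indices are 0-based: with b := sort leq a, the b_i of the usual 1-based     *)
(* definition is nth 0 b i.-1, so that b_i < i (2 <= i <= n) reads             *)
(* nth 0 b i < i.+1 for 1 <= i < n.                                            *)
Definition prime_parking (a : seq nat) : bool :=
  let b := sort leq a in
  [&& all (leq 1) a, nth 0 b 0 == 1
    & [forall i : 'I_(size a), (1 <= i) ==> (nth 0 b i < i.+1)]].

Definition des (a : seq nat) : nat :=
  \sum_(0 <= i < (size a).-1) (nth 0 a i > nth 0 a i.+1).

(* The bound n on the entries, which makes the ambient type finite, is no      *)
(* restriction: see prime_parking_le and PPF_complete.                         *)
Definition PPF (n : nat) : {set n.-tuple 'I_n.+1} :=
  [set a : n.-tuple 'I_n.+1 | prime_parking [seq val x | x <- a]].

(* The subtraction in the exponent does not truncate: see des_le.              *)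
Definition ptilde (n : nat) : {poly int} :=
  (\sum_(a in PPF n) 'X^(n.-1 - des [seq val x | x <- a]))%R.

Lemma des_le (a : seq nat) : des a <= (size a).-1.
Proof.
rewrite /des -[X in _ <= X]subn0 -[X in _ <= X]muln1 -sum_nat_const_nat.
by apply: leq_sum => i _; case: (_ < _).
Qed.

Lemma prime_parking_le (a : seq nat) :
  prime_parking a -> all (fun x => x <= size a) a.
Proof.
case/and3P=> _ /eqP b0 /forallP bP; apply/allP => x.
rewrite -(mem_sort leq) => /(nthP 0) [i]; rewrite size_sort => lt_i <-.
case: (posnP i) => [i0|i_gt0].
  by move: lt_i; rewrite i0 b0.
have := bP (Ordinal lt_i); rewrite /= i_gt0 /= ltnS => /leq_trans; apply.
exact: ltnW.
Qed.

Lemma PPF_complete (n : nat) (s : seq nat) :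
  size s = n -> prime_parking s ->
  exists2 a : n.-tuple 'I_n.+1, a \in PPF n & [seq val x | x <- a] = s.
Proof.
move=> sz_s pp_s; have /allP le_s := prime_parking_le pp_s.
have sz : size (map (@inord n) s) == n by rewrite size_map sz_s.
have eq_s : [seq val x | x <- Tuple sz] = s.
  rewrite /= -map_comp -[RHS]map_id; apply/eq_in_map => x /le_s.
  by rewrite sz_s => le_x /=; rewrite inordK.
by exists (Tuple sz); rewrite // inE eq_s.
Qed.

(* Main.v *)
(* The word sums over all of [n-1]^n and over prime parking functions are     *)
(* proportional: after averaging over rotations of the positions, the weight  *)
(* t^(n-1-des) becomes a function of the number of cyclic ascents, which is   *)
(* invariant under adding a constant to all letters modulo n-1, and by the    *)
(* cycle lemma each orbit of this translation contains exactly one prime      *)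
(* parking function.                                                          *)
(* The sums f_i over words with first letter i satisfy                        *)
(*   g_i = sum_(j < i) f_j + t * sum_(j >= i) f_j                             *)
(* when the length grows by one.  For Im t > 0 this recursion preserves the   *)
(* property that the f_i have decreasing arguments and lie in a cone of angle *)
(* arg t < pi, so their sum does not vanish; conjugation handles Im t < 0.    *)
Require Import Defs.
From mathcomp Require Import all_boot all_order all_algebra.
From mathcomp Require Import complex reals.
From mathcomp Require Import zify ring lra.

Set Implicit Arguments.
Unset Strict Implicit.
Unset Printing Implicit Defensive.

Import Order.TTheory GRing.Theory Num.Theory.

Local Open Scope ring_scope.
Local Open Scope complex_scope.

(** With [n = k.+2], [sum_PPF] and [sum_weight_prime_words] show that [k.+1] times the polynomial
    and the weight sum over all words of length [n] on [n - 1] letters agree up to the factor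
    [k.+2]. The two ingredients are [exists_unique_prime_shift] and [cyclic_ascents_shift]. The sum
    over all words is handled by a transfer recursion on the first letter: [cone_ordered_step] keeps
    its terms in a cone narrower than a half-plane, whence [sum_weight_words_neq0] in the upper
    half-plane. *)

(** * Weights of words and the recursion on the first letter *)

Section Weight.

Variables (K : comNzRingType) (t : K).

Definition step_weight (x y : nat) : K := if (x <= y)%N then t else 1.

Definition weight (a : seq nat) : K :=
  \prod_(0 <= i < (size a).-1) step_weight (nth 0%N a i) (nth 0%N a i.+1).

Lemma weight_des (a : seq nat) : weight a = t ^+ ((size a).-1 - des a).
Proof.
rewrite /weight /des; elim: (size a).-1 => [|k IH]; first by rewrite !big_nil.
rewrite !big_nat_recr //= IH /step_weight.
have le_k : (\sum_(0 <= i < k) (nth 0%N a i > nth 0%N a i.+1) <= k)%N.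
  rewrite -[leqRHS]subn0 -[leqRHS]muln1 -sum_nat_const_nat.
  by apply: leq_sum => i _; case: (_ < _)%N.
case: leqP => _ /=; last by rewrite addn1 subSS mulr1.
by rewrite addn0 subSn // exprSr.
Qed.

Lemma weight_cons (x y : nat) (s : seq nat) :
  weight (x :: y :: s) = step_weight x y * weight (y :: s).
Proof. by rewrite /weight /= big_nat_recl. Qed.

Definition head_sum (m l : nat) (i : 'I_m) : K :=
  \sum_(w : l.-tuple 'I_m) weight (val i :: map val w).

Lemma sum_tuple_cons (T : finType) (l : nat) (F : l.+1.-tuple T -> K) :
  \sum_w F w = \sum_x \sum_(w : l.-tuple T) F [tuple of x :: w].
Proof.
rewrite pair_big /= (reindex (fun p : T * l.-tuple T => [tuple of p.1 :: p.2])) //=.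
exists (fun w : l.+1.-tuple T => (thead w, [tuple of behead w])).
  by move=> [x w] _; congr pair; apply: val_inj.
by move=> w _; rewrite -tuple_eta.
Qed.

Lemma head_sum0 (m : nat) (i : 'I_m) : head_sum 0 i = 1.
Proof.
rewrite /head_sum (eq_bigr (fun=> 1)) => [|w _].
  by rewrite sumr_const card_tuple expn0.
by rewrite tuple0 /weight big_nil.
Qed.

Lemma head_sumS (m l : nat) (i : 'I_m) :
  head_sum l.+1 i = \sum_(j < m) step_weight i j * head_sum l j.
Proof.
rewrite /head_sum sum_tuple_cons; apply: eq_bigr => j _.
by rewrite mulr_sumr; apply: eq_bigr => w _; rewrite -weight_cons.
Qed.

Lemma sum_weight_head (m l : nat) :
  \sum_(w : l.+1.-tuple 'I_m) weight (map val w) = \sum_(i < m) head_sum l i.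
Proof. exact: sum_tuple_cons. Qed.

End Weight.

(** * Non-vanishing of the sum over all words in the upper half-plane *)

Section Wedge.

Variable R : rcfType.
Implicit Types (u v t : R[i]).

(** This is the imaginary part of [conjc u * v]: nonnegative when [v] lies counterclockwise of [u]
    by at most a half-turn. *)
Definition wedge u v : R :=
  complex.Re u * complex.Im v - complex.Im u * complex.Re v.

Lemma wedge_suml (I : Type) (r : seq I) (P : pred I) (F : I -> R[i]) v :
  wedge (\sum_(i <- r | P i) F i) v = \sum_(i <- r | P i) wedge (F i) v.
Proof.
apply: (big_morph (wedge^~ v)) => [[a b] [c d]|]; case: v => ? ?; rewrite /wedge /=; ring.
Qed.

Lemma wedge_sumr (I : Type) (r : seq I) (P : pred I) (F : I -> R[i]) u :
  wedge u (\sum_(i <- r | P i) F i) = \sum_(i <- r | P i) wedge u (F i).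
Proof.
apply: (big_morph (wedge u)) => [[a b] [c d]|]; case: u => ? ?; rewrite /wedge /=; ring.
Qed.

Definition normsq u : R := complex.Re u ^+ 2 + complex.Im u ^+ 2.

Lemma normsq_ge0 u : 0 <= normsq u.
Proof. by rewrite addr_ge0 ?sqr_ge0. Qed.

Lemma normsq_gt0 u : u != 0 -> 0 < normsq u.
Proof.
rewrite lt0r normsq_ge0 andbT; apply: contra; case: u => a b.
by rewrite /normsq paddr_eq0 ?sqr_ge0 // !sqrf_eq0 => /andP[/= /eqP-> /eqP->].
Qed.

Lemma wedge_self u t : wedge u (t * u) = complex.Im t * normsq u.
Proof. by case: u t => [a b] [c d]; rewrite /wedge /normsq /=; ring. Qed.

(** The arguments are the new values at indices [b] and [a], [a <= b], when [P], [Q], [S] sum the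
    old ones below [a], from [a] to below [b], and from [b] on. All terms pairing [P] with [S]
    cancel. *)
Lemma wedge_stepl (P Q S t : R[i]) :
  wedge (P + Q + t * S) (P + t * (Q + S)) =
    wedge P (t * Q) + wedge Q P + complex.Im t * normsq Q + wedge Q (t * S)
    + normsq t * wedge S Q.
Proof.
case: P Q S t => [p p'] [q q'] [s s'] [x y]; rewrite /wedge /normsq /=; ring.
Qed.

(** Here the pairing of [P] with [S] is absorbed into [normsq (P + t * S)]. *)
Lemma wedge_stepr (P Q S t : R[i]) :
  wedge (P + t * (Q + S)) (t * (P + Q + t * S)) =
    complex.Im t * normsq (P + t * S) + wedge P (t * Q)
    + normsq t * (wedge Q P + wedge Q (t * S) + wedge S Q).
Proof.
case: P Q S t => [p p'] [q q'] [s s'] [x y]; rewrite /wedge /normsq /=; ring.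
Qed.

(* The arguments of the f i decrease with i, by at most arg t in total. *)
Definition cone_ordered (m : nat) (t : R[i]) (f : 'I_m -> R[i]) : Prop :=
  forall i j : 'I_m, (i <= j)%N ->
    0 <= wedge (f j) (f i) /\ 0 <= wedge (f i) (t * f j).

Lemma sum_step_weight (m : nat) (t : R[i]) (f : 'I_m -> R[i]) (i : 'I_m) :
  \sum_(j < m) step_weight t i j * f j =
    \sum_(j < m | (j < i)%N) f j + t * \sum_(j < m | (i <= j)%N) f j.
Proof.
rewrite (bigID (fun j : 'I_m => (j < i)%N)) /= mulr_sumr; congr (_ + _).
  by apply: eq_bigr => j; rewrite /step_weight ltnNge => /negbTE->; rewrite mul1r.
by apply: eq_big => j; rewrite /step_weight -leqNgt // => ->.
Qed.

Lemma cone_ordered_step (m : nat) (t : R[i]) (f : 'I_m -> R[i]) :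
  0 < complex.Im t -> cone_ordered t f ->
  cone_ordered t (fun i : 'I_m => \sum_(j < m) step_weight t i j * f j).
Proof.
move=> t_gt0 fP a b le_ab; rewrite !sum_step_weight.
set P := \sum_(j < m | (j < a)%N) f j; set S := \sum_(j < m | (b <= j)%N) f j.
pose Q := \sum_(j < m | (a <= j < b)%N) f j.
have -> : \sum_(j < m | (j < b)%N) f j = P + Q.
  rewrite (bigID (fun j : 'I_m => (j < a)%N)) /=; congr (_ + _); apply: eq_bigl => j.
    by apply: andb_idl => /leq_trans; apply.
  by rewrite -leqNgt andbC.
have -> : \sum_(j < m | (a <= j)%N) f j = Q + S.
  rewrite (bigID (fun j : 'I_m => (j < b)%N)) /=; congr (_ + _); apply: eq_bigl => j.
  by rewrite -leqNgt; apply: andb_idl; apply: leq_trans.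
have wS_ge0 (p q : pred 'I_m) : (forall i j, p i -> q j -> (i <= j)%N) ->
    0 <= wedge (\sum_(j | q j) f j) (\sum_(j | p j) f j)
    /\ 0 <= wedge (\sum_(j | p j) f j) (t * \sum_(j | q j) f j).
  move=> pq; rewrite mulr_sumr !wedge_suml.
  split; apply: sumr_ge0 => i hi; rewrite wedge_sumr; apply: sumr_ge0 => j hj.
    by case: (fP _ _ (pq _ _ hj hi)).
  by case: (fP _ _ (pq _ _ hi hj)).
have [PQ1 PQ2] : 0 <= wedge Q P /\ 0 <= wedge P (t * Q).
  by apply: wS_ge0 => i j /ltnW ia /andP[/(leq_trans ia)].
have [QS1 QS2] : 0 <= wedge S Q /\ 0 <= wedge Q (t * S).
  by apply: wS_ge0 => i j /andP[_ /ltnW ib] /(leq_trans ib).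
have t_ge0 := ltW t_gt0; split.
  by rewrite wedge_stepl; do ?[apply: addr_ge0 => //]; apply: mulr_ge0 => //;
    apply: normsq_ge0.
rewrite wedge_stepr; do ?[apply: addr_ge0 => //]; apply: mulr_ge0 => //;
  try exact: normsq_ge0.
by do ?[apply: addr_ge0 => //].
Qed.

Lemma cone_ordered_head_sum (m : nat) (t : R[i]) (l : nat) : 0 < complex.Im t ->
  cone_ordered t (fun i : 'I_m.+1 => head_sum t l i) /\ head_sum t l (@ord_max m) != 0.
Proof.
move=> t_gt0; elim: l => [|l [fP f_neq0]].
  split=> [i j _|]; rewrite !head_sum0 ?oner_neq0 //.
  by rewrite wedge_self /wedge /normsq /=; split; nra.
split=> [i j|].
  rewrite !head_sumS; exact: cone_ordered_step.
apply/eqP => g_eq0.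
(* In the recursion at the last index only the last term carries [t], and it contributes
   [complex.Im t * normsq] of a nonzero value; the others contribute nonnegatively. *)
suff : 0 < wedge (head_sum t l (@ord_max m)) (head_sum t l.+1 (@ord_max m)).
  by rewrite g_eq0 /wedge /= !mulr0 subrr ltxx.
rewrite head_sumS wedge_sumr (bigD1 ord_max) //= {1}/step_weight leqnn wedge_self.
rewrite ltr_pwDl ?mulr_gt0 ?normsq_gt0 //; apply: sumr_ge0 => j j_neq.
have le_j := leq_ord j; rewrite /step_weight leqNgt ltn_neqAle le_j andbT.
by rewrite -(inj_eq val_inj) in j_neq; rewrite j_neq mul1r; case: (fP j ord_max le_j).
Qed.

Lemma sum_weight_words_neq0 (m l : nat) (t : R[i]) : 0 < complex.Im t ->
  \sum_(w : l.+1.-tuple 'I_m.+1) weight t (map val w) != 0.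
Proof.
move=> t_gt0; rewrite sum_weight_head.
have [fP f_neq0] := cone_ordered_head_sum m l t_gt0.
apply/eqP => sum_eq0.
suff : 0 < wedge (\sum_(i < m.+1) head_sum t l i) (t * head_sum t l (@ord_max m)).
  by rewrite sum_eq0 /wedge /= !mul0r subrr ltxx.
rewrite wedge_suml (bigD1 ord_max) //= wedge_self ltr_pwDl //.
  by rewrite mulr_gt0 // normsq_gt0.
by apply: sumr_ge0 => j _; case: (fP j ord_max (leq_ord j)).
Qed.

End Wedge.

(** * The cycle lemma *)

Section CycleLemma.

Local Open Scope nat_scope.

Lemma divn_lt_double (a m : nat) : a < m.*2 -> a %/ m = (m <= a).
Proof.
move=> lt_a; case: leqP => [le_ma|/divn_small //].
by rewrite -(subnK le_ma) divnDr // divnn divn_small; lia.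
Qed.

(** The quotient [(y + m.-1 - v) %/ m] counts the integers below [y] congruent to [v] modulo [m]; a
    window of length [x <= m] starting at [p] holds at most one of them. *)
Lemma ltn_mod_sub (m p v x : nat) : p < m -> v < m -> 0 < x <= m ->
  (p + x + m.-1 - v) %/ m = (p + m.-1 - v) %/ m + ((v + (m - p)) %% m < x).
Proof.
move=> lt_p lt_v x_bd; case: (leqP p v) => [le_pv|lt_vp].
  have -> : v + (m - p) = v - p + m by lia.
  by rewrite modnDr modn_small ?divn_lt_double; lia.
have -> : p + x + m.-1 - v = (p + x - v).-1 + m by lia.
by rewrite divnDr // divnn modn_small ?divn_lt_double; lia.
Qed.

Lemma exists_last_argmin (h : nat -> nat) (k : nat) :
  exists p, [/\ p <= k, forall y, y <= k -> h p <= h y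
                & forall y, p < y <= k -> h p < h y].
Proof.
elim: k => [|k [p [le_pk p_min p_last]]].
  by exists 0; split=> // y; case: y.
case: (leqP (h k.+1) (h p)) => [le_h|lt_h].
  exists k.+1; split=> // y; last by case: ltnP.
  rewrite leq_eqVlt ltnS => /predU1P[-> //|/p_min]; exact: leq_trans.
exists p; split=> [|y|y]; first exact: leqW.
  by rewrite leq_eqVlt ltnS => /predU1P[->|/p_min //]; exact: ltnW.
by case/andP=> lt_py; rewrite leq_eqVlt ltnS => /predU1P[-> //|le_yk]; rewrite p_last ?lt_py.
Qed.

(* G y - y grows by 1 along each period, and the only valid starting point is *)
(* the last minimum of G y - y on the first period.                           *)
Lemma cycle_lemma (k : nat) (G : nat -> nat) :
  (forall y, G (y + k.+1) = G y + k.+2) ->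
  exists2 p, p <= k & forall q, q <= k ->
    (forall x, 0 < x <= k.+1 -> G q + x < G (q + x)) <-> q = p.
Proof.
move=> Gper.
(* For [y <= k] this function is [G y - y] plus the constant [k], kept within [nat]. *)
have [p [le_pk p_min p_last]] := exists_last_argmin (fun y => G y + (k - y)) k.
have p_ok x : 0 < x <= k.+1 -> G p + x < G (p + x).
  move=> x_bd; case: (leqP (p + x) k) => [le_k|lt_k].
    by have := p_last (p + x); lia.
  have le_x : p + x - k.+1 <= k by lia.
  have := Gper (p + x - k.+1); have := p_min _ le_x.
  by rewrite subnK; lia.
exists p => // q le_qk; split=> [q_ok|-> //].
(* From [a] to [b] and from [b] to [a + k.+1], [G y - y] would rise at least once each, but it rises
   by only 1 over a period. *)
have ltn_absurd a b : a < b -> b <= k ->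
    (forall x, 0 < x <= k.+1 -> G a + x < G (a + x)) ->
    (forall x, 0 < x <= k.+1 -> G b + x < G (b + x)) -> False.
  move=> lt_ab le_bk a_ok b_ok; have := a_ok (b - a); have := b_ok (a + k.+1 - b).
  by rewrite !subnKC ?Gper; lia.
by case: (ltngtP q p) => // [lt|lt]; [case: (@ltn_absurd q p)|case: (@ltn_absurd p q)].
Qed.

End CycleLemma.

(** * Rotations of positions and translations of letters *)

Section Words.

Variable k : nat.
Local Notation word := (k.+2.-tuple 'I_k.+1).
Implicit Types (w : word) (r : 'I_k.+2) (s : 'I_k.+1).

(** Addition of ordinals is modular: positions are taken modulo [k.+2] here, letters modulo [k.+1]
    in [shift]. *)
Definition rotate w r : word := [tuple tnth w (i + r) | i < k.+2].

Definition shift w s : word := [tuple tnth w i + s | i < k.+2].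

(* Letters are 0-based: they are the entries of a prime parking function     *)
(* lowered by 1.                                                             *)
Definition prime_word w : bool :=
  [forall x : 'I_k.+1, (x.+1 < \sum_(i < k.+2) (tnth w i <= x))%N].

Lemma rotate_bij r : bijective (rotate^~ r).
Proof.
exists (rotate^~ (- r)) => w; apply: eq_from_tnth => i;
  by rewrite !tnth_mktuple ?addrNK ?addrK.
Qed.

Lemma shift_bij s : bijective (shift^~ s).
Proof.
exists (shift^~ (- s)) => w; apply: eq_from_tnth => i;
  by rewrite !tnth_mktuple ?addrNK ?addrK.
Qed.

Lemma prime_word_rotate w r : prime_word (rotate w r) = prime_word w.
Proof.
apply: eq_forallb => x; congr (_ < _)%N.
rewrite [RHS](reindex_inj (addIr r)); apply: eq_bigr => i _.
by rewrite tnth_mktuple.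
Qed.

(** Lowering the letters by [q] moves the origin of the letter count to [q], so primality says that
    [q] is a valid start in [cycle_lemma]. *)
Lemma exists_unique_prime_shift w : (\sum_s prime_word (shift w s))%N = 1%N.
Proof.
(* G y counts the pairs (i, v) with 0 <= v < y and v = w_i mod k.+1. *)
pose G y := (\sum_(i < k.+2) (y + k - tnth w i) %/ k.+1)%N.
have Gper y : G (y + k.+1)%N = (G y + k.+2)%N.
  have -> : (G y + k.+2 = G y + \sum_(i < k.+2) 1)%N by rewrite sum1_card card_ord.
  rewrite -big_split; apply: eq_bigr => i _ /=; have := ltn_ord (tnth w i).
  move: (val (tnth w i)) => v lt_v.
  have -> : (y + k.+1 + k - v = y + k - v + k.+1)%N by lia.
  by rewrite divnDr // divnn.
have Gsum p x : (p <= k)%N -> (0 < x <= k.+1)%N ->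
    (G (p + x) = G p + \sum_(i < k.+2) ((tnth w i + (k.+1 - p)) %% k.+1 < x))%N.
  move=> le_p x_bd; rewrite -big_split; apply: eq_bigr => i _ /=.
  exact: (@ltn_mod_sub k.+1).
have [p le_pk pP] := cycle_lemma Gper.
have primeP (q : 'I_k.+1) : prime_word (shift w (- q)) <->
    (forall x, 0 < x <= k.+1 -> G q + x < G (q + x))%N.
  have le_qk : (q <= k)%N by rewrite -ltnS.
  have sumE x : (\sum_(i < k.+2) (tnth (shift w (- q)) i < x) =
      \sum_(i < k.+2) ((tnth w i + (k.+1 - q)) %% k.+1 < x))%N.
    by apply: eq_bigr => i _; rewrite tnth_mktuple /= modnDmr.
  split=> [/forallP qP [//|x] /= x_bd|qP].
    rewrite (Gsum q) // ltn_add2l -sumE.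
    exact: (qP (Ordinal (x_bd : (x < k.+1)%N))).
  apply/forallP => x; have := qP x.+1 (ltn_ord x).
  by rewrite (Gsum q) //= ?ltn_ord // ltn_add2l -sumE.
rewrite (reindex_inj oppr_inj) /= (bigD1 (inord p)) //= big1 => [|q q_neq].
  by rewrite (primeP _).2 // inordK //; apply/(pP p le_pk).
case: (boolP (prime_word _)) => // /primeP/(pP q (leq_ord q)) q_p.
by case/eqP: q_neq; apply: val_inj; rewrite /= inordK.
Qed.

(** * Averaging over rotations *)

Section Averaging.

Variables (K : comNzRingType) (t : K).

Definition ascent w (i : 'I_k.+2) : bool := (tnth w i <= tnth w (i + 1)%R)%N.

Definition cyclic_ascents w : nat := (\sum_i ascent w i)%N.

Lemma weight_tuple w :
  weight t (map val w) = t ^+ (cyclic_ascents w - ascent w ord_max).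
Proof.
rewrite /cyclic_ascents (bigD1 ord_max) //= addKn -prodrXr /weight.
rewrite size_map size_tuple big_mkord [RHS]big_mkcond [RHS]big_ord_recr /= eqxx mulr1.
apply: eq_bigr => i _; rewrite -(inj_eq val_inj) /= (ltn_eqF (ltn_ord i)) /=.
have le_i : (i <= k)%N := leq_ord i.
rewrite /step_weight /ascent !(tnth_nth ord0) /= modnDmr addn1 modn_small ?ltnS //.
rewrite !(nth_map ord0) ?size_tuple ?ltnS ?(leqW le_i) //.
by case: (_ <= _)%N.
Qed.

(** The total weight of all rotations of [w], indexed by the cyclic position [r] at which the cycle
    is cut. *)
Definition rotation_sum w : K :=
  \sum_(r < k.+2) t ^+ (cyclic_ascents w - ascent w r).

(** Cutting at a cyclic ascent loses one factor [t], cutting elsewhere loses none. Without cyclic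
    ascents the truncated exponent has multiplicity 0. *)
Lemma rotation_sum_cyclic_ascents w : rotation_sum w =
  t ^+ (cyclic_ascents w).-1 *+ cyclic_ascents w
  + t ^+ cyclic_ascents w *+ (k.+2 - cyclic_ascents w).
Proof.
have card_ascent : #|ascent w| = cyclic_ascents w.
  by rewrite -sum1_card big_mkcond; apply: eq_bigr => i _;
    rewrite -topredE /=; case: (ascent w i).
rewrite /rotation_sum (bigID (ascent w)) /=; congr (_ + _).
  rewrite (eq_bigr (fun=> t ^+ (cyclic_ascents w).-1)) => [|i ->]; last by rewrite subn1.
  by rewrite sumr_const card_ascent.
rewrite (eq_bigr (fun=> t ^+ cyclic_ascents w)) => [|i /negbTE->]; last by rewrite subn0.
rewrite sumr_const; congr (_ *+ _).
by rewrite -[X in (X - _)%N]card_ord -(cardC (ascent w)) card_ascent addKn.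
Qed.

Lemma cyclic_ascents_shift w s : cyclic_ascents (shift w s) = cyclic_ascents w.
Proof.
pose h (x : 'I_k.+1) : bool := (k < x + s)%N.
(* Letters that wrap around change the comparisons by terms that telescope *)
(* around the cycle.                                                       *)
have step i : (ascent (shift w s) i + h (tnth w (i + 1)%R) = ascent w i + h (tnth w i))%N.
  rewrite /ascent !tnth_mktuple /h /=.
  move: (tnth w i) (tnth w (i + 1)) => [x lt_x] [y lt_y]; case: s {h} => s lt_s /=.
  have modE z : (z < k.+1)%N -> ((z + s) %% k.+1 = z + s - (k < z + s) * k.+1)%N.
    move=> lt_z; case: leqP => le_z; first by rewrite mul0n subn0 modn_small.
    by rewrite mul1n -[in LHS](subnK le_z) modnDr modn_small //; lia.
  by rewrite !modE //; case: (ltnP k (x + s)); case: (ltnP k (y + s)); lia.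
apply/eqP; rewrite -(eqn_add2r (\sum_i h (tnth w i))) -[in X in _ == X]big_split /=.
rewrite [X in (_ + X)%N == _](reindex_inj (addIr 1)) -big_split /=.
by apply/eqP/eq_bigr => i _; apply: step.
Qed.

Lemma cyclic_ascents_rotate w r : cyclic_ascents (rotate w r) = cyclic_ascents w.
Proof.
rewrite [RHS](reindex_inj (addIr r)); apply: eq_bigr => i _.
by rewrite /ascent !tnth_mktuple addrAC.
Qed.

Lemma ascent_rotate w r i : ascent (rotate w r) i = ascent w (i + r).
Proof. by rewrite /ascent !tnth_mktuple addrAC. Qed.

Lemma sum_rotation_sum (P : pred word) : (forall w r, P (rotate w r) = P w) ->
  \sum_(w | P w) rotation_sum w = (\sum_(w | P w) weight t (map val w)) *+ k.+2.
Proof.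
move=> P_rot; rewrite exchange_big /=.
rewrite (eq_bigr (fun=> \sum_(w | P w) weight t (map val w))) => [|r _].
  by rewrite sumr_const card_ord.
(* This rotation brings position [r] to [ord_max], the comparison that [weight] omits. *)
rewrite [RHS](reindex _ (onW_bij _ (rotate_bij (r - ord_max)))).
apply: eq_big => [w|w _]; first by rewrite P_rot.
by rewrite weight_tuple cyclic_ascents_rotate ascent_rotate addrC subrK.
Qed.

(** Each word is weighted by its number of prime shifts, which is 1; after exchanging sums, each of
    the [k.+1] shifts yields the prime sum. *)
Lemma sum_rotation_sum_words :
  \sum_w rotation_sum w = (\sum_(w | prime_word w) rotation_sum w) *+ k.+1.
Proof.
have -> : \sum_w rotation_sum w = \sum_w \sum_s
    (if prime_word (shift w s) then rotation_sum w else 0).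
  apply: eq_bigr => w _; rewrite -[LHS]mulr1n -(exists_unique_prime_shift w).
  by rewrite -sumrMnr; apply: eq_bigr => s _; case: (prime_word _).
rewrite exchange_big (eq_bigr (fun=> \sum_(w | prime_word w) rotation_sum w)) => [|s _].
  by rewrite sumr_const card_ord.
rewrite -big_mkcond [RHS](reindex _ (onW_bij _ (shift_bij s))).
apply: eq_bigr => w _.
by rewrite !rotation_sum_cyclic_ascents cyclic_ascents_shift.
Qed.

Lemma sum_weight_prime_words :
  (\sum_(w : word) weight t (map val w)) *+ k.+2 =
  (\sum_(w : word | prime_word w) weight t (map val w)) *+ (k.+1 * k.+2).
Proof.
rewrite -(@sum_rotation_sum predT) // sum_rotation_sum_words.
by rewrite (sum_rotation_sum prime_word_rotate) mulnC mulrnA.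
Qed.

End Averaging.

End Words.

(** * Prime parking functions as prime words *)

Section PrimeParking.

Local Open Scope nat_scope.

Lemma nth_sorted_lt (b : seq nat) (i v : nat) : sorted leq b -> i < size b ->
  (nth 0 b i < v) = (i < count (fun x => x < v) b).
Proof.
elim: b i => [//|x b IH] i /= b_sorted lt_i.
have x_min := order_path_min leq_trans b_sorted.
case: (ltnP x v) => [lt_xv|le_vx] /=.
  by case: i lt_i => [|i] //= lt_i; rewrite IH // (path_sorted b_sorted).
have -> : count (fun y => y < v) b = 0.
  apply/eqP; rewrite -leqn0 leqNgt -has_count; apply/hasPn => y /(allP x_min) le_xy.
  by rewrite -leqNgt (leq_trans le_vx).
apply/negbTE; rewrite -leqNgt; case: i lt_i => [|i] //= lt_i.
by rewrite (leq_trans le_vx) // (allP x_min) // mem_nth.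
Qed.

Lemma prime_parking_count (s : seq nat) : 1 < size s ->
  prime_parking [seq x.+1 | x <- s] =
  [forall x : 'I_(size s).-1, x.+1 < count (fun y => y <= x) s].
Proof.
move=> s_gt1; rewrite /prime_parking all_map.
set b := sort _ _; have b_sorted : sorted leq b by apply: sort_sorted; apply: leq_total.
have nthE i v : i < size s -> (nth 0 b i < v.+1) = (i < count (fun y => y < v) s).
  move=> lt_i; rewrite nth_sorted_lt ?size_sort ?size_map //.
  rewrite /b (permP (permEl (perm_sort _ _))) count_map.
  by congr (_ < _); apply: eq_count.
have b_gt0 i : i < size s -> 0 < nth 0 b i.
  move=> lt_i; have : nth 0 b i \in b by rewrite mem_nth // size_sort size_map.
  by rewrite mem_sort => /mapP[x _ ->].
rewrite (_ : all _ _) /=; last by apply/allP.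
apply/andP/forallP => [[_ /forallP sP] [x lt_x]|sP].
  have lt_x1 : x.+1 < size s by lia.
  have lt_x1' : x.+1 < size [seq x.+1 | x <- s] by rewrite size_map.
  have := sP (Ordinal lt_x1').
  by rewrite /= nthE.
have lt0 : 0 < (size s).-1 by lia.
split.
  (* The count at [x = 0] forces a letter 0, hence a least entry equal to 1. *)
  rewrite eqn_leq b_gt0 ?andbT; last by lia.
  rewrite -ltnS nthE; last by lia.
  by have := sP (Ordinal lt0); apply: ltn_trans.
apply/forallP => -[[|x] lt_x] //=; rewrite size_map in lt_x.
have lt_x' : x < (size s).-1 by lia.
by rewrite nthE //; have := sP (Ordinal lt_x').
Qed.

Lemma prime_parking_lt (a : seq nat) (x : nat) :
  1 < size a -> prime_parking a -> x \in a -> 0 < x < size a.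
Proof.
move=> a_gt1 /and3P[/allP a_gt0 /eqP b0 /forallP bP] x_a.
rewrite [0 < x]a_gt0 //=.
have x_b : x \in sort leq a by rewrite mem_sort.
case: (nthP 0 x_b) => i; rewrite size_sort => lt_i <-.
case: (posnP i) => [->|i_gt0]; first by rewrite b0.
by have := bP (Ordinal lt_i); rewrite /= i_gt0 => /leq_trans; apply.
Qed.

Lemma des_map_succ (s : seq nat) : des [seq x.+1 | x <- s] = des s.
Proof.
rewrite /des size_map; apply: eq_big_nat => i /andP[_ lt_i].
by rewrite !(nth_map 0) //; lia.
Qed.

End PrimeParking.

Lemma sum_PPF (K : comNzRingType) (t : K) (k : nat) :
  \sum_(a in PPF k.+2) t ^+ (k.+1 - des (map val a)) =
  \sum_(w : k.+2.-tuple 'I_k.+1 | prime_word w) weight t (map val w).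
Proof.
pose up (w : k.+2.-tuple 'I_k.+1) : k.+2.-tuple 'I_k.+3 :=
  [tuple of [seq inord (val x).+1 | x <- w]].
pose down (a : k.+2.-tuple 'I_k.+3) : k.+2.-tuple 'I_k.+1 :=
  [tuple of [seq inord (val x).-1 | x <- a]].
have upE w : map val (up w) = [seq x.+1 | x <- map val w].
  by rewrite /= -!map_comp; apply: eq_map => x /=; rewrite inordK //; have := ltn_ord x; lia.
have upK : cancel up down.
  move=> w; apply: val_inj; rewrite /= -map_comp map_id_in // => x _ /=.
  by rewrite inordK ?inord_val //; have := ltn_ord x; lia.
rewrite (reindex_onto up down) => [|a]; last first.
  rewrite inE => a_prime; apply: val_inj; rewrite /= -map_comp map_id_in // => x x_a /=.
  have := prime_parking_lt _ a_prime (map_f val x_a).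
  rewrite size_map size_tuple => /(_ isT) /andP[x_gt0 lt_x].
  by apply: val_inj; rewrite /= inordK ?inordK ?prednK //; lia.
apply: eq_big => w; last first.
  by move=> _; rewrite upE des_map_succ weight_des size_map size_tuple.
rewrite upK eqxx andbT inE upE prime_parking_count ?size_map ?size_tuple //.
apply: eq_forallb => x; congr (_ < _)%N.
by rewrite count_map -sum1_count big_tuple big_mkcond.
Qed.

Theorem theorem1p4 (R : realType) (n : nat) (hn : (2 <= n)%N) (z : R[i]) :
  root (map_poly intr (ptilde n)) z -> complex.Im z = 0.
Proof.
case: n hn => [|[|k]] // _.
have no_root (t : R[i]) : 0 < complex.Im t -> ~~ root (map_poly intr (ptilde k.+2)) t.
  move=> t_gt0; apply: contra (sum_weight_words_neq0 k k.+1 t_gt0) => /eqP.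
  rewrite /ptilde rmorph_sum horner_sum /= => sum_eq0.
  suff : (\sum_(w : k.+2.-tuple 'I_k.+1) weight t (map val w)) *+ k.+2 == 0.
    by rewrite mulrn_eq0.
  rewrite sum_weight_prime_words -sum_PPF.
  rewrite [X in X *+ _](_ : _ = 0) ?mul0rn // -[RHS]sum_eq0.
  by apply: eq_bigr => a _; rewrite map_polyXn hornerXn.
move=> z_root; case: (ltrgtP (complex.Im z) 0) => // [lt0|/no_root]; last by rewrite z_root.
have : ~~ root (map_poly intr (ptilde k.+2)) (conjc z).
  by apply: no_root; case: z lt0 {z_root} => a b; rewrite /= oppr_gt0.
(* Integer coefficients are fixed by conjugation, so [conjc z] is a root as well. *)
rewrite (_ : map_poly intr _ = map_poly conjc (map_poly intr (ptilde k.+2))).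
  by rewrite fmorph_root z_root.
by rewrite -map_poly_comp; apply: eq_map_poly => c /=; rewrite rmorph_int.
Qed.
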